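(* Let $m,n\ge 1$, let $A_1,\dots,A_m$ be normal $n\times n$ complex matrices, let $Z_1,\dots,Z_m$ be expansive $n\times n$ complex matrices (that is, $Z_i^*Z_i\ge I$ for each $i$), and let $f:[0,\infty)\to[0,\infty)$ be a concave function. Then $$ \left\|f\left(\left|\sum_{i=1}^m Z_i^*A_iZ_i\right|\right)\right\|_{\infty}\le\left\|\sum_{i=1}^m Z_i^*f(|A_i|)Z_i\right\|_{\infty}. $$
   Context: For a complex matrix $X$, $|X|=(X^*X)^{1/2}$. For a positive semi-definite $P$, $f(P)$ is defined by the functional calculus. The order $\ge$ is the usual (Loewner) order on Hermitian matrices, and $I$ is the identity. $\|\cdot\|_\infty$ denotes the usual operator norm (largest singular value). *)

(* Defs.v *)
From HB Require Import structures.
From mathcomp Require Import all_boot all_order all_algebra.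
From mathcomp Require Import sesquilinear spectral complex.
From mathcomp Require Import classical_sets set_interval reals convex.

Set Implicit Arguments.
Unset Strict Implicit.
Unset Printing Implicit Defensive.

Import Order.TTheory GRing.Theory Num.Theory.

Local Open Scope ring_scope.
Local Open Scope sesquilinear_scope.
Local Open Scope complex_scope.
Local Open Scope classical_set_scope.

Definition concave_function (R : realType) (D : set R) (f : R -> R) : Prop :=
  convex_function (E := R^o) D (fun x => - f x).

Section MatrixDefs.
Variables (R : realType) (n : nat).
Implicit Types A B P X Z : 'M[R[i]]_n.

(* On R[i], [0 <= z] means that z is real and nonnegative. *)
Definition psdmx A : Prop :=
  A \is hermsymmx /\ forall v : 'cV[R[i]]_n, 0 <= (v^t* *m A *m v) 0 0.

Definition loewner_le A B : Prop := psdmx (B - A).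

Definition expansivemx Z : Prop := loewner_le 1%:M (Z^t* *m Z).

(* For Hermitian P, P = U^-1 diag(d) U with U := spectralmx P unitary and
   d := spectral_diag P real; f(P) is then U^-1 diag(f(d)) U. *)
Definition mxfun (f : R -> R) P : 'M[R[i]]_n :=
  invmx (spectralmx P)
    *m diag_mx (\row_j (f (complex.Re (spectral_diag P 0 j)))%:C)
    *m spectralmx P.

Definition absmx X : 'M[R[i]]_n := mxfun Num.sqrt (X^t* *m X).

Definition singular_value X (j : 'I_n) : R :=
  Num.sqrt (complex.Re (spectral_diag (X^t* *m X) 0 j)).

(* Singular values are nonnegative, so the base value 0 of the maximum only
   matters for n = 0. *)
Definition opnorm X : R := \big[Num.max/0]_(j < n) singular_value X j.

End MatrixDefs.

(* Main.v *)
Require Import Defs.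
From HB Require Import structures.
From mathcomp Require Import all_boot all_order all_algebra.
From mathcomp Require Import sesquilinear spectral complex.
From mathcomp Require Import classical_sets set_interval reals convex.
From mathcomp Require Import unstable interval_inference ring lra.

Set Implicit Arguments.
Unset Strict Implicit.
Unset Printing Implicit Defensive.

Import Order.TTheory GRing.Theory Num.Theory.

Local Open Scope ring_scope.
Local Open Scope sesquilinear_scope.
Local Open Scope complex_scope.
Local Open Scope classical_set_scope.

(** Put T = sum Z_i^* |A_i| Z_i and let t be its largest eigenvalue, with unit
    eigenvector w.
    - Normality gives 2 Re <A u, v> <= <|A| u, u> + <|A| v, v>, whence every singular
      value of S = sum Z_i^* A_i Z_i is at most t.
    - As the Z_i are expansive, |A_i| <= t I too: if |A_i| u = a u and Z_i w' = u, then
      a |u|^2 <= <T w', w'> <= t |w'|^2 <= t |u|^2.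
    - A nonnegative concave f on [0, +oo[ is nondecreasing and satisfies
      a f(t) <= t f(a) for 0 <= a <= t, so f(|A_i|) >= (f(t) / t) |A_i| if t > 0; testing
      G = sum Z_i^* f(|A_i|) Z_i against w gives |G| >= f(t) >= |f(|S|)|.
    - If t = 0, then all the |A_i| vanish and expansiveness alone gives
      <G w, w> >= f(0). *)

(** * Nonnegative concave functions on the half-line *)

Section ConcaveFunctions.
Variables (R : realType) (f : R -> R).
Hypothesis f_ge0 : forall x, 0 <= x -> 0 <= f x.
Hypothesis f_concave : concave_function `[0, +oo[ f.

Lemma concave_ge (l x y : R) : 0 <= l -> l <= 1 -> 0 <= x -> 0 <= y ->
  l * f x + (1 - l) * f y <= f (l * x + (1 - l) * y).
Proof.
move=> l0 l1 x0 y0.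
have := @f_concave (Itv01 l0 l1) x y.
rewrite !inE /= !in_itv /= !andbT => /(_ x0 y0).
by rewrite !convRE /= /onem !mulrN -opprD lerN2.
Qed.

Lemma concave_ge0_homo (x y : R) : 0 <= x -> x <= y -> f x <= f y.
Proof.
move=> x0; rewrite le_eqVlt => /orP[/eqP-> //|xy]; rewrite leNgt; apply/negP => fyx.
have fy0 : 0 <= f y by apply: f_ge0; lra.
(* Continue past [y] to the point [z] with y = l x + (1 - l) z. As l > f y / f x, concavity and f z
   >= 0 would give f y >= l f x > f y. *)
set l := (1 + f y / f x) / 2.
have fx0 : 0 < f x by lra.
have q0 : 0 <= f y / f x by rewrite divr_ge0 // ltW.
have q1 : f y / f x < 1 by rewrite ltr_pdivrMr // mul1r.
have l0 : 0 <= l by rewrite /l; lra.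
have l1 : 0 < 1 - l by rewrite /l; lra.
set z := (y - l * x) / (1 - l).
have yE : l * x + (1 - l) * z = y.
  by rewrite /z mulrCA divff ?lt0r_neq0 // mulr1; ring.
have z0 : 0 <= z by rewrite divr_ge0 ?(ltW l1) //; nra.
have := concave_ge l0 _ x0 z0; rewrite yE => /(_ ltac:(lra)).
have fz0 := mulr_ge0 (ltW l1) (f_ge0 z0).
have lfx : l * f x = (f x + f y) / 2 by rewrite /l; field; lra.
by rewrite lfx; lra.
Qed.

(** Concavity between [t] and 0 with weight a / t on [t]; the term in f 0 is nonnegative and is
    dropped. When t = 0 both sides vanish. *)
Lemma concave_ge0_star (a t : R) : 0 <= a -> a <= t -> a * f t <= t * f a.
Proof.
move=> a0 at0; have [t0|t_le0] := ltP 0 t; last first.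
  have -> : t = 0 by lra.
  have -> : a = 0 by lra.
  by rewrite !mul0r.
have l0 : 0 <= a / t by rewrite divr_ge0 // ltW.
have l1 : a / t <= 1 by rewrite ler_pdivrMr // mul1r.
have := concave_ge l0 l1 (ltW t0) (lexx 0); rewrite mulr0 addr0 divfK ?gt_eqF //.
have := mulr_ge0 (_ : 0 <= 1 - a / t) (f_ge0 (lexx 0)); rewrite subr_ge0 => /(_ l1).
move=> h1 h2; have h3 : a / t * f t <= f a by lra.
have := ler_wpM2l (ltW t0) h3; rewrite mulrA mulrCA divff ?gt_eqF // mulr1 //.
Qed.

End ConcaveFunctions.

(** * Diagonalization of normal matrices *)

Lemma normal_spectral (C : numClosedFieldType) n (A : 'M[C]_n) : A \is normalmx ->
  A = (spectralmx A)^t* *m diag_mx (spectral_diag A) *m spectralmx A.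
Proof.
by move=> /orthomx_spectralP AE; rewrite -invmx_unitary ?spectral_unitarymx.
Qed.

Lemma tr_conj_diag (C : numClosedFieldType) n (V : 'M[C]_n) (d : 'rV_n) :
  (V^t* *m diag_mx d *m V)^t* = V^t* *m diag_mx (map_mx Num.conj d) *m V.
Proof. by rewrite !trmx_mul !map_mxM /= trmxCK tr_diag_mx map_diag_mx mulmxA. Qed.

(** * The real inner product Re <u, v> and its coordinates *)

Section RealInnerProduct.
Variable R : realType.
Local Notation C := R[i].

(* C^n as a real Euclidean space. *)
Definition rdot n (u v : 'cV[C]_n) : R := complex.Re ((u^t* *m v) 0 0).

Lemma rdotE n (u v : 'cV[C]_n) :
  rdot u v = \sum_j (complex.Re (u j 0) * complex.Re (v j 0)
                     + complex.Im (u j 0) * complex.Im (v j 0)).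
Proof.
rewrite /rdot mxE (raddf_sum (@complex.Re R : Rcomplex R -> R)) /=.
apply: eq_bigr => j _; rewrite !mxE.
by case: (u j 0) (v j 0) => [a b] [c d] /=; ring.
Qed.

Lemma rdot_ge0 n (u : 'cV[C]_n) : 0 <= rdot u u.
Proof. by rewrite rdotE sumr_ge0 // => j _; nra. Qed.

Lemma rdot_eq0 n (u : 'cV[C]_n) : rdot u u = 0 -> u = 0.
Proof.
rewrite rdotE => /eqP; rewrite psumr_eq0 => [/allP u0|j _]; last by nra.
apply/colP => j; rewrite mxE; have := u0 j (mem_index_enum _); case: (u j 0) => a b /=.
by rewrite paddr_eq0 ?sqr_ge0 // -?expr2 ?sqr_ge0 // !sqrf_eq0 => /andP[/eqP-> /eqP->].
Qed.

Lemma rdotM m n (u : 'cV[C]_m) (M : 'M_(m, n)) (v : 'cV[C]_n) :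
  rdot u (M *m v) = rdot (M^t* *m u) v.
Proof. by rewrite /rdot trmx_mul map_mxM /= trmxCK mulmxA. Qed.

Lemma rdot_unitary n (V : 'M[C]_n) (u v : 'cV[C]_n) : V \is unitarymx ->
  rdot (V *m u) (V *m v) = rdot u v.
Proof.
rewrite -trmxC_unitary => /unitarymxP; rewrite trmxCK => VV.
by rewrite rdotM mulmxA VV mul1mx.
Qed.

Lemma rdotC n (u v : 'cV[C]_n) : rdot u v = rdot v u.
Proof. by rewrite !rdotE; apply: eq_bigr => j _; ring. Qed.

Lemma rdotDr n (u v w : 'cV[C]_n) : rdot u (v + w) = rdot u v + rdot u w.
Proof. by rewrite /rdot mulmxDr mxE; case: (_ 0 0) (_ 0 0) => ? ? []. Qed.

Lemma rdotZr n (a : R) (u v : 'cV[C]_n) : rdot u (a%:C *: v) = a * rdot u v.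
Proof. by rewrite /rdot -scalemxAr mxE; case: (_ 0 0) => b c /=; ring. Qed.

Lemma rdot_sumr n (I : finType) (u : 'cV[C]_n) (F : I -> 'cV[C]_n) :
  rdot u (\sum_i F i) = \sum_i rdot u (F i).
Proof.
apply: (big_morph (rdot u)) => [v w|]; first exact: rdotDr.
by rewrite /rdot mulmx0 mxE.
Qed.

(** Kept apart from [mxfun] so that [V] may be any unitary that diagonalizes the matrix, not only
    the one picked by [spectralmx]. *)
Definition hdiag n (V : 'M[C]_n) (d : 'I_n -> R) : 'M[C]_n :=
  V^t* *m diag_mx (\row_j (d j)%:C) *m V.

Lemma eq_hdiag n (V : 'M[C]_n) (d e : 'I_n -> R) : d =1 e -> hdiag V d = hdiag V e.
Proof.
move=> de; rewrite /hdiag (_ : \row_j _ = \row_j (e j)%:C) //.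
by apply/rowP => j; rewrite !mxE de.
Qed.

(** Squared modulus, valued in R so that sums of it compare in the real order. *)
Definition msq (z : C) : R := complex.Re z ^+ 2 + complex.Im z ^+ 2.

Lemma msq_ge0 z : 0 <= msq z. Proof. by rewrite addr_ge0 ?sqr_ge0. Qed.

Lemma rdot_msq n (u : 'cV[C]_n) : rdot u u = \sum_j msq (u j 0).
Proof. by rewrite rdotE. Qed.

Lemma rdot_hdiag n (V : 'M[C]_n) (d : 'I_n -> R) (u : 'cV[C]_n) :
  rdot u (hdiag V d *m u) = \sum_j d j * msq ((V *m u) j 0).
Proof.
rewrite /hdiag -!mulmxA rdotM trmxCK rdotE; apply: eq_bigr => j _.
by rewrite mul_diag_mx !mxE /msq; case: (\sum_ _ _) => a b /=; ring.
Qed.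

Lemma rdot_unitary_msq n (V : 'M[C]_n) (u : 'cV[C]_n) : V \is unitarymx ->
  rdot u u = \sum_j msq ((V *m u) j 0).
Proof. by move=> Vu; rewrite -(rdot_unitary _ _ Vu) rdot_msq. Qed.

(** The vector is the adjoint of row [j] of [V]: the j-th eigenvector of every [hdiag V d]. *)
Lemma unitary_row_unit n (V : 'M[C]_n) (j : 'I_n) : V \is unitarymx ->
  rdot (V^t* *m delta_mx j 0) (V^t* *m delta_mx j (0 : 'I_1)) = 1.
Proof.
move=> Vu; rewrite rdot_unitary ?trmxC_unitary // rdot_msq (bigD1 j) //= big1 => [|k kj].
  by rewrite mxE !eqxx /msq /=; ring.
by rewrite mxE (negPf kj) /msq /=; ring.
Qed.

Lemma hdiag_eigen n (V : 'M[C]_n) (d : 'I_n -> R) (j : 'I_n) : V \is unitarymx ->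
  hdiag V d *m (V^t* *m delta_mx j (0 : 'I_1)) = (d j)%:C *: (V^t* *m delta_mx j 0).
Proof.
move=> /unitarymxP Vu; rewrite /hdiag -!mulmxA (mulmxA V) Vu mul1mx scalemxAr; congr (_ *m _).
apply/colP => k; rewrite mul_diag_mx !mxE eqxx andbT.
by case: eqP => [->|_]; rewrite ?mulr1n ?mulr0n ?mulr1 ?mulr0.
Qed.

(** * Hermitian matrices and the functional calculus *)

Lemma hermsymmxP n (P : 'M[C]_n) : reflect (P^t* = P) (P \is hermsymmx).
Proof. by apply: (iffP (is_hermitianmxP _ _ _)); rewrite expr0 scale1r. Qed.

Lemma hdiag_hermsym n (V : 'M[C]_n) (d : 'I_n -> R) : (hdiag V d)^t* = hdiag V d.
Proof.
rewrite /hdiag tr_conj_diag (_ : map_mx _ _ = \row_j (d j)%:C) //.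
by apply/rowP => j; rewrite 3!mxE; apply: conjc_real.
Qed.

Lemma mxfunE n (P : 'M[C]_n) (f : R -> R) :
  mxfun f P = hdiag (spectralmx P) (fun j => f (complex.Re (spectral_diag P 0 j))).
Proof. by rewrite /hdiag -invmx_unitary ?spectral_unitarymx. Qed.

(* Two unitary diagonalizations of the same matrix are related by a unitary W
   with W i j * d j = d' i * W i j, so W i j = 0 unless d j = d' i. *)
Lemma mxfun_hdiag n (V : 'M[C]_n) (d : 'I_n -> R) (f : R -> R) : V \is unitarymx ->
  mxfun f (hdiag V d) = hdiag V (f \o d).
Proof.
move=> Vu; have /unitarymxP VV := Vu.
have /mulmx1C VV' := VV.
have : hdiag V d \is normalmx by apply: hermitian_normalmx; exact/hermsymmxP/hdiag_hermsym.
have [P PV] : exists P, P = hdiag V d by exists (hdiag V d).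
rewrite -PV mxfunE => /normal_spectral.
have := spectral_unitarymx P; move: (spectralmx P) (spectral_diag P) => U e.
move=> /unitarymxP UU PE.
set W := U *m V^t*.
have UE : U = W *m V by rewrite /W -mulmxA VV' mulmx1.
have WE : W *m diag_mx (\row_j (d j)%:C) = diag_mx e *m W.
  have : U *m P *m V^t* = diag_mx e *m W.
    by rewrite [X in U *m X]PE /W !mulmxA UU mul1mx.
  by move=> <-; rewrite PV /hdiag /W -!mulmxA VV mulmx1 !mulmxA.
have WfE : W *m diag_mx (\row_j (f (d j))%:C)
         = diag_mx (\row_j (f (complex.Re (e 0 j)))%:C) *m W.
  apply/matrixP => i j; have /matrixP/(_ i j) := WE.
  rewrite !mul_mx_diag !mul_diag_mx !mxE mulrC => /eqP.
  rewrite -subr_eq0 -mulrBl mulf_eq0 subr_eq0 => /orP[/eqP <- /=|/eqP->].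
    by rewrite mulrC.
  by rewrite mulr0 mul0r.
have UU' := mulmx1C UU.
by rewrite /hdiag -mulmxA {2}UE (mulmxA (diag_mx _)) -WfE /W !mulmxA UU' mul1mx.
Qed.

Lemma rdot_hdiag_sq n (V : 'M[C]_n) (d : 'I_n -> R) (u : 'cV[C]_n) : V \is unitarymx ->
  rdot (hdiag V d *m u) (hdiag V d *m u) = \sum_j d j ^+ 2 * msq ((V *m u) j 0).
Proof.
move=> Vu; rewrite /hdiag -!mulmxA rdot_unitary ?trmxC_unitary // rdotE.
apply: eq_bigr => j _.
by rewrite mul_diag_mx !mxE /msq; case: (\sum_ _ _) => a b /=; ring.
Qed.

(** Eigenvalues of a Hermitian matrix are real, so taking real parts changes nothing. *)
Lemma hermsym_hdiag n (P : 'M[C]_n) : P \is hermsymmx ->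
  P = hdiag (spectralmx P) (fun j => complex.Re (spectral_diag P 0 j)).
Proof.
move=> Ph; have PE := normal_spectral (hermitian_normalmx Ph).
rewrite {1}PE /hdiag (_ : \row_j _ = spectral_diag P) //; apply/rowP => j; rewrite mxE.
by have /mxOverP/(_ 0 j)/RRe_real := hermitian_spectral_diag_real Ph.
Qed.

(** * Singular values and the operator norm *)

Lemma rdot_mul_gram n (X : 'M[C]_n) (u : 'cV[C]_n) :
  rdot (X *m u) (X *m u) = rdot u (X^t* *m X *m u).
Proof. by rewrite rdotM mulmxA rdotC. Qed.

(** [Num.sqrt] is 0 on negative numbers, so the eigenvalue must be shown nonnegative: it equals |X
    u|^2 for a unit eigenvector u of X^* X. *)
Lemma singular_value_sqr n (X : 'M[C]_n) j :
  singular_value X j ^+ 2 = complex.Re (spectral_diag (X^t* *m X) 0 j).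
Proof.
rewrite /singular_value sqr_sqrtr //.
have /hermsym_hdiag : X^t* *m X \is hermsymmx.
  by apply/hermsymmxP; rewrite trmx_mul map_mxM /= trmxCK.
have := spectral_unitarymx (X^t* *m X).
move: (spectralmx _) (spectral_diag _) => U e Uu PE.
have := rdot_ge0 (X *m (U^t* *m delta_mx j (0 : 'I_1))).
by rewrite rdot_mul_gram PE hdiag_eigen // rdotZr unitary_row_unit // mulr1.
Qed.

Lemma gram_hdiag n (X : 'M[C]_n) :
  X^t* *m X = hdiag (spectralmx (X^t* *m X)) (fun j => singular_value X j ^+ 2).
Proof.
have /hermsym_hdiag {1}-> : X^t* *m X \is hermsymmx.
  by apply/hermsymmxP; rewrite trmx_mul map_mxM /= trmxCK.
by apply: eq_hdiag => j; rewrite singular_value_sqr.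
Qed.

Lemma absmx_hdiag n (X : 'M[C]_n) :
  absmx X = hdiag (spectralmx (X^t* *m X)) (singular_value X).
Proof. exact: mxfunE. Qed.

Lemma singular_vector n (X : 'M[C]_n) (j : 'I_n) : exists2 u : 'cV_n,
  rdot u u = 1 & rdot (X *m u) (X *m u) = singular_value X j ^+ 2.
Proof.
have := spectral_unitarymx (X^t* *m X); have := gram_hdiag X.
move: (spectralmx _) => U XX Uu.
exists (U^t* *m delta_mx j 0); first exact: unitary_row_unit.
by rewrite rdot_mul_gram XX hdiag_eigen // rdotZr unitary_row_unit // mulr1.
Qed.

(** With [opnorm_ge], this identifies the largest singular value with the least c >= 0 such that |X
    u| <= c |u| for all u. *)
Lemma opnorm_le n (X : 'M[C]_n) (c : R) : 0 <= c ->
  (forall u, rdot (X *m u) (X *m u) <= c ^+ 2 * rdot u u) -> opnorm X <= c.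
Proof.
move=> c0 Xc; apply: bigmax_le => // j _.
rewrite -ler_sqr ?nnegrE ?sqrtr_ge0 //; have [u u1 <-] := singular_vector X j.
by rewrite (le_trans (Xc u)) // u1 mulr1.
Qed.

Lemma opnorm_ge n (X : 'M[C]_n) (u : 'cV[C]_n) :
  rdot (X *m u) (X *m u) <= opnorm X ^+ 2 * rdot u u.
Proof.
rewrite rdot_mul_gram gram_hdiag rdot_hdiag.
rewrite (rdot_unitary_msq u (spectral_unitarymx (X^t* *m X))) mulr_sumr.
apply: ler_sum => j _; rewrite ler_wpM2r ?msq_ge0 //.
have sj : singular_value X j <= opnorm X by apply: le_bigmax.
by rewrite ler_sqr ?nnegrE ?sqrtr_ge0 // (le_trans (sqrtr_ge0 _) sj).
Qed.

Lemma opnorm_ge0 n (X : 'M[C]_n) : 0 <= opnorm X.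
Proof. exact: bigmax_ge_id. Qed.

Lemma rdot_le_opnorm n (X : 'M[C]_n) (u : 'cV[C]_n) :
  rdot u u = 1 -> rdot u (X *m u) <= opnorm X.
Proof.
move=> u1; set c := rdot u (X *m u).
have [c0|/ltW c0] := leP c 0; first exact: le_trans c0 (opnorm_ge0 X).
rewrite -ler_sqr ?nnegrE ?opnorm_ge0 //.
have := opnorm_ge X u; rewrite u1 mulr1; apply: le_trans.
(* Since c = Re <u, X u> and |u| = 1, expanding |X u - c u|^2 >= 0 gives |X u|^2 >= c^2. *)
have := rdot_ge0 (X *m u + (- c)%:C *: u).
rewrite rdotDr rdotZr !(rdotC (_ + _)) !rdotDr !rdotZr (rdotC (X *m u) u) -/c u1.
have sqr_le (p r : R) : 0 <= p + - r * r + - r * (r + - r * 1) -> r ^+ 2 <= p.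
  by move=> h; lra.
exact: sqr_le.
Qed.

(** * Expansive matrices and sums of congruences *)

Lemma expansive_rdot n (Z : 'M[C]_n) (u : 'cV[C]_n) : expansivemx Z ->
  rdot u u <= rdot (Z *m u) (Z *m u).
Proof.
case=> _ /(_ u).
have -> : u^t* *m (Z^t* *m Z - 1%:M) *m u = (Z *m u)^t* *m (Z *m u) - u^t* *m u.
  by rewrite mulmxBr mulmxBl mulmx1 trmx_mul map_mxM /= !mulmxA.
rewrite mxE [X in _ + X]mxE subr_ge0 lecE => /andP[_]; exact.
Qed.

(** From |v| <= |Z v| the kernel is trivial; it is read as the row kernel of the transpose. *)
Lemma expansive_unit n (Z : 'M[C]_n) : expansivemx Z -> Z \in unitmx.
Proof.
move=> Ze; rewrite -unitmx_tr -row_free_unit -kermx_eq0; apply/rowV0P => v /sub_kermxP vZ.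
have := @expansive_rdot _ Z v^T Ze.
have -> : Z *m v^T = 0 by rewrite -[Z]trmxK -trmx_mul vZ trmx0.
rewrite [X in _ <= X]/rdot mulmx0 mxE /= => v0.
have /rdot_eq0 /(congr1 trmx) : rdot v^T v^T = 0.
  by apply/eqP; rewrite eq_le v0 rdot_ge0.
by rewrite trmxK trmx0.
Qed.

Lemma rdot_sum_congr n m (Z B : 'I_m -> 'M[C]_n) (u v : 'cV[C]_n) :
  rdot u ((\sum_(i < m) (Z i)^t* *m B i *m Z i) *m v)
    = \sum_(i < m) rdot (Z i *m u) (B i *m (Z i *m v)).
Proof.
rewrite mulmx_suml rdot_sumr; apply: eq_bigr => i _.
by rewrite -!mulmxA [LHS]rdotM trmxCK.
Qed.

Lemma hermsym_sum_congr n m (Z B : 'I_m -> 'M[C]_n) :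
  (forall i, (B i)^t* = B i) ->
  \sum_(i < m) (Z i)^t* *m B i *m Z i \is hermsymmx.
Proof.
move=> Bh; apply/hermsymmxP; rewrite raddf_sum map_mx_sum; apply: eq_bigr => i _.
by rewrite /= !trmx_mul !map_mxM /= trmxCK Bh mulmxA.
Qed.

(** * The absolute value of a normal matrix *)

Section Normal.
Variables (n : nat) (A : 'M[C]_n).
Hypothesis A_normal : A \is normalmx.
Let V := spectralmx A.
Let Vu : V \is unitarymx := spectral_unitarymx A.
Let a j := Num.sqrt (msq (spectral_diag A 0 j)).

(** [absmx A] uses the eigenbasis chosen for A^* A, but A^* A is also diagonal in the basis [V] of
    [A], with entries |d_j|^2; [mxfun_hdiag] allows the change to [V]. *)
Lemma normal_absmx : absmx A = hdiag V a.
Proof.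
have := normal_spectral A_normal; rewrite -/V => AE.
set d := spectral_diag A in AE.
rewrite /absmx -/d; have -> : A^t* *m A = hdiag V (fun j => msq (d 0 j)).
  rewrite AE !trmx_mul !map_mxM /= trmxCK tr_diag_mx map_diag_mx /hdiag -!mulmxA.
  have /unitarymxP VV := Vu; rewrite (mulmxA V) VV mul1mx (mulmxA (diag_mx _)) mulmx_diag.
  congr (_ *m (diag_mx _ *m _)); apply/rowP => j; rewrite !mxE.
  by rewrite /msq add_Re2_Im2 normCKC.
exact: mxfun_hdiag.
Qed.

Lemma normal_absmx_eigen j : exists2 u : 'cV_n,
  rdot u u = 1 & absmx A *m u = (a j)%:C *: u.
Proof.
exists (V^t* *m delta_mx j 0); first exact: unitary_row_unit.
by rewrite normal_absmx hdiag_eigen.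
Qed.

Lemma normal_absmx_rdot_ge0 (u : 'cV[C]_n) : 0 <= rdot u (absmx A *m u).
Proof.
rewrite normal_absmx rdot_hdiag sumr_ge0 // => j _.
by rewrite mulr_ge0 ?sqrtr_ge0 ?msq_ge0.
Qed.

Lemma normal_mxfun_absmx f : mxfun f (absmx A) = hdiag V (f \o a).
Proof. by rewrite normal_absmx mxfun_hdiag. Qed.

Lemma normal_rdot_le (u v : 'cV[C]_n) :
  rdot u (A *m v) *+ 2 <= rdot u (absmx A *m u) + rdot v (absmx A *m v).
Proof.
rewrite normal_absmx !rdot_hdiag -big_split /=.
have AE := normal_spectral A_normal; rewrite -/V in AE.
rewrite {1}AE -!mulmxA rdotM trmxCK rdotE -sumrMnl; apply: ler_sum => j _.
rewrite mul_diag_mx [(\matrix_(_, _) _) j 0]mxE -mulrDr.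
rewrite /a; set s := Num.sqrt _.
have s0 : 0 <= s by rewrite sqrtr_ge0.
have s2 : s ^+ 2 = msq (spectral_diag A 0 j) by rewrite sqr_sqrtr ?msq_ge0.
move: s2; rewrite /msq.
case: (spectral_diag A 0 j) ((V *m u) j 0) ((V *m v) j 0) => p q [b c] [d e] /= s2.
set w := _ + _; set X := b ^+ 2 + _; set Y := d ^+ 2 + _.
have X0 : 0 <= X by rewrite addr_ge0 ?sqr_ge0.
have Y0 : 0 <= Y by rewrite addr_ge0 ?sqr_ge0.
(* In an eigenbasis of A the claim is 2 w <= s (X + Y) with w^2 <= s^2 X Y. *)
have w_le : w ^+ 2 <= s ^+ 2 * (X * Y).
  rewrite s2 /w /X /Y -subr_ge0.
  set r := (X in 0 <= X).
  (* With x = b + ic, y = d + ie and z = p + iq, [w] is the real part of conj(x) z y, and the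
     difference is the square of its imaginary part. *)
  have -> : r = (p * (b * e - c * d) + q * (b * d + c * e)) ^+ 2 by rewrite /r; ring.
  exact: sqr_ge0.
have sXY : 0 <= s * (X + Y) by rewrite mulr_ge0 // addr_ge0.
have [w0|w0] := leP w 0.
  by rewrite (le_trans _ sXY) ?pmulrn_lle0.
rewrite -ler_sqr ?nnegrE ?mulrn_wge0 ?(ltW w0) //.
(* Arithmetic-geometric mean: 4 X Y = (X + Y)^2 - (X - Y)^2. *)
have : 0 <= s ^+ 2 * (X - Y) ^+ 2 by rewrite mulr_ge0 ?sqr_ge0.
by rewrite -mulr_natl !exprMn; lra.
Qed.

End Normal.

(** * The largest eigenvalue of a Hermitian matrix *)

Lemma hermsym_max_eigen n (P : 'M[C]_n) : (0 < n)%N -> P \is hermsymmx ->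
  exists (t : R) (w : 'cV[C]_n), [/\ rdot w w = 1, P *m w = t%:C *: w &
    forall u, rdot u (P *m u) <= t * rdot u u].
Proof.
move=> n0 /hermsym_hdiag; set d := (fun j => _); set U := spectralmx P => PE.
have Uu : U \is unitarymx := spectral_unitarymx P.
have [k _ dk] := arg_maxP d (erefl (xpredT (Ordinal n0))).
exists (d k), (U^t* *m delta_mx k 0); split; first exact: unitary_row_unit.
  by rewrite {1}PE hdiag_eigen.
move=> u; rewrite PE rdot_hdiag (rdot_unitary_msq u Uu) mulr_sumr.
by apply: ler_sum => j _; rewrite ler_wpM2r ?msq_ge0 //; exact: dk.
Qed.

(** * Consequences of the bound sum Z_i^* |A_i| Z_i <= t I *)

Section NormalCongruence.
Variables (m n : nat) (A Z : 'I_m -> 'M[C]_n).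
Hypothesis A_normal : forall i, A i \is normalmx.
Variable t : R.
Hypothesis t_ge0 : 0 <= t.
Hypothesis abs_le : forall u,
  \sum_(i < m) rdot (Z i *m u) (absmx (A i) *m (Z i *m u)) <= t * rdot u u.

(** For a singular value s > 0 of the sum S with unit singular vector x, put y = S x / s, a unit
    vector with <y, S x> = s. Summing [normal_rdot_le] at Z_i y and Z_i x gives 2 s <= t + t. *)
Lemma singular_value_sum_congr_le j :
  singular_value (\sum_(i < m) (Z i)^t* *m A i *m Z i) j <= t.
Proof.
have [x x1] := singular_vector (\sum_(i < m) (Z i)^t* *m A i *m Z i) j.
move: (singular_value _ j) => s; have [s0 _|s0 Sx] := leP s 0; first exact: le_trans t_ge0.
have [y y1 ySx] : exists2 y,
    rdot y y = 1 & rdot y ((\sum_(i < m) (Z i)^t* *m A i *m Z i) *m x) = s.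
  move: (\sum_(i < m) _) Sx => S Sx; have ySx : rdot ((s^-1)%:C *: (S *m x)) (S *m x) = s.
    by rewrite rdotC rdotZr Sx expr2 mulKf ?gt_eqF.
  by exists ((s^-1)%:C *: (S *m x)); rewrite // rdotZr ySx mulVf ?gt_eqF.
have := lerD (abs_le y) (abs_le x); rewrite x1 y1 mulr1 -mulr2n => Tt.
rewrite -(@ler_pMn2r _ 2) // -ySx (le_trans _ Tt) // rdot_sum_congr -big_split -sumrMnl.
by apply: ler_sum => i _; exact: normal_rdot_le.
Qed.

Lemma normal_eigen_le (i : 'I_m) j : expansivemx (Z i) ->
  Num.sqrt (msq (spectral_diag (A i) 0 j)) <= t.
Proof.
move=> Ze; have [u u1 Au] := normal_absmx_eigen (A_normal i) j.
have [w Zw] : exists w, Z i *m w = u.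
  by exists (invmx (Z i) *m u); rewrite mulKVmx ?expansive_unit.
have w1 : rdot w w <= 1 by rewrite -u1 -Zw expansive_rdot.
have : t * rdot w w <= t by rewrite -[leRHS]mulr1 ler_wpM2l.
apply: le_trans; apply: le_trans (abs_le w).
(* The i-th summand at [w] is the eigenvalue itself; the other summands are nonnegative. *)
rewrite (bigD1 i) //= Zw Au rdotZr u1 mulr1 lerDl sumr_ge0 // => k _.
exact: normal_absmx_rdot_ge0.
Qed.

End NormalCongruence.

(** In the eigenbasis of X^* X, f(|X|) is diagonal with entries f(s_j), each in [0, c]. *)
Lemma opnorm_mxfun_absmx_le n (X : 'M[C]_n) (f : R -> R) (c : R) : 0 <= c ->
  (forall j, 0 <= f (singular_value X j) <= c) -> opnorm (mxfun f (absmx X)) <= c.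
Proof.
move=> c0 fc; have Uu := spectral_unitarymx (X^t* *m X).
rewrite absmx_hdiag mxfun_hdiag //; apply: opnorm_le => // u.
rewrite rdot_hdiag_sq // (rdot_unitary_msq u Uu) mulr_sumr.
apply: ler_sum => j _; rewrite ler_wpM2r ?msq_ge0 //=.
by have /andP[f0 fle] := fc j; rewrite ler_sqr ?nnegrE.
Qed.

End RealInnerProduct.

(** * Comparison of both norms through f(t) *)

Theorem corollary1p2 (R : realType) (m n : nat) (hm : (0 < m)%N) (hn : (0 < n)%N)
    (A Z : 'I_m -> 'M[R[i]]_n) (f : R -> R)
    (hA : forall i, A i \is normalmx)
    (hZ : forall i, expansivemx (Z i))
    (hf_ge0 : forall x : R, 0 <= x -> 0 <= f x)
    (hf_concave : concave_function `[0, +oo[ f) :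
  opnorm (mxfun f (absmx (\sum_(i < m) (Z i)^t* *m A i *m Z i)))
    <= opnorm (\sum_(i < m) (Z i)^t* *m mxfun f (absmx (A i)) *m Z i).
Proof.
have Th : \sum_(i < m) (Z i)^t* *m absmx (A i) *m Z i \is hermsymmx.
  by apply: hermsym_sum_congr => i; rewrite normal_absmx // hdiag_hermsym.
have [t [w [w1 Tw Tle]]] := hermsym_max_eigen hn Th.
have {}Tw : \sum_(i < m) rdot (Z i *m w) (absmx (A i) *m (Z i *m w)) = t.
  by rewrite -rdot_sum_congr Tw rdotZr w1 mulr1.
have {}Tle u : \sum_(i < m) rdot (Z i *m u) (absmx (A i) *m (Z i *m u)) <= t * rdot u u.
  by rewrite -rdot_sum_congr.
pose V i := spectralmx (A i); pose a i j := Num.sqrt (msq (spectral_diag (A i) 0 j)).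
(* Squared coordinates of Z_i w in the eigenbasis of A_i: they serve as common weights for <T w, w>
   and <G w, w>. *)
pose q i j := msq ((V i *m (Z i *m w)) j 0).
have q0 i j : 0 <= q i j by exact: msq_ge0.
have a0 i j : 0 <= a i j by exact: sqrtr_ge0.
have tE : t = \sum_i \sum_j a i j * q i j.
  rewrite -{1}Tw; apply: eq_bigr => i _.
  by rewrite normal_absmx // rdot_hdiag.
have t0 : 0 <= t.
  by rewrite tE; apply: sumr_ge0 => i _; apply: sumr_ge0 => j _; rewrite mulr_ge0.
have a_le i j : a i j <= t by exact: normal_eigen_le.
have ft0 := hf_ge0 _ t0.
apply: (@le_trans _ _ (f t)).
  apply: opnorm_mxfun_absmx_le => // j.
  have s0 : 0 <= singular_value (\sum_(i < m) (Z i)^t* *m A i *m Z i) j.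
    exact: sqrtr_ge0.
  rewrite hf_ge0 //= concave_ge0_homo //; exact: singular_value_sum_congr_le.
apply: le_trans (rdot_le_opnorm _ w1).
rewrite rdot_sum_congr.
under eq_bigr => i _ do rewrite normal_mxfun_absmx // rdot_hdiag /=.
rewrite -/(a _ _).
have [t_gt0|t_le0] := ltP 0 t.
  (* Multiplied by t, the claim follows termwise from a f(t) <= t f(a), weighted by [q]. *)
  rewrite -(ler_pM2l t_gt0) {1}tE mulr_suml mulr_sumr; apply: ler_sum => i _.
  rewrite mulr_suml mulr_sumr; apply: ler_sum => j _.
  by rewrite mulrAC mulrA ler_wpM2r // concave_ge0_star.
(* Now t = 0, which squeezes every modulus between 0 and t. *)
have aE i j : a i j = t.
  by apply/eqP; rewrite eq_le a_le (le_trans t_le0).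
(* A single index suffices, and m > 0 supplies one: its term is f(t) |Z w|^2 >= f(t), and the other
   terms are nonnegative. *)
pose i0 := Ordinal hm.
rewrite (bigD1 i0) //= -[leLHS]addr0 lerD //; last first.
  apply: sumr_ge0 => i _; apply: sumr_ge0 => j _.
  by rewrite mulr_ge0 ?hf_ge0 ?msq_ge0 //; exact: sqrtr_ge0.
have := expansive_rdot w (hZ i0).
rewrite w1 (rdot_unitary_msq _ (spectral_unitarymx (A i0))) => q1.
have -> : f t = f t * 1 by rewrite mulr1.
rewrite (le_trans (ler_wpM2l ft0 q1)) // mulr_sumr.
by apply: ler_sum => j _; have := aE i0 j; rewrite /a => ->.
Qed.
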